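(* Let $K$ be an $F$-finite field of prime characteristic $p$, let $G$ be a closed simple graph on $[n]=\{1,\ldots,n\}$, let $S=K[x_1,\ldots,x_n,y_1,\ldots,y_n]$ with maximal homogeneous ideal $\mathfrak{m}$, and let $\mathcal{J}_G\subseteq S$ be the binomial edge ideal of $G$. Then $\operatorname{fpt}(S/\mathcal{J}_G)=2$.
   Context: A field $K$ of characteristic $p>0$ is $F$-finite if $[K:K^p]<\infty$. Graphs: a simple graph has no loops or multiple edges. For a simple graph $G$ on $[n]$ with edge set $E(G)$, the binomial edge ideal is $\mathcal{J}_G=(f_{ij} : \{i,j\}\in E(G),\ i<j)\subseteq S$, where $f_{ij}=x_iy_j-x_jy_i$. The graph $G$ is closed with respect to the given labelling of its vertices if for all distinct edges $\{i,j\}$ and $\{k,l\}$ with $i<j$ and $k<l$, one has $\{j,l\}\in E(G)$ if $i=k$, and $\{i,k\}\in E(G)$ if $j=l$. $G$ is closed if there exists a labelling of its vertices such that $G$ is closed with respect to that labelling. $F$-pure threshold: a ring $R$ of characteristic $p$ is $F$-pure if the Frobenius map $F:R\to R$, $r\mapsto r^p$, is a pure homomorphism of $R$-modules; it is $F$-finite if $F$ makes $R$ a finitely generated $R$-module. For reduced $R$, $R^{1/p^e}$ denotes the ring of $p^e$-th roots of elements of $R$. Let $(R,\mathfrak{m}_R,K)$ be a standard graded $K$-algebra with maximal homogeneous ideal $\mathfrak{m}_R$ which is $F$-finite and $F$-pure. For a homogeneous ideal $I\subseteq R$ and a real number $\lambda\geq 0$, the pair $(R,I^\lambda)$ is $F$-pure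 if for every $e\gg 0$ there is $f\in I^{\lfloor (p^e-1)\lambda\rfloor}$ such that the inclusion of $R$-modules $f^{1/p^e}R\subseteq R^{1/p^e}$ splits. Then $\operatorname{fpt}(I)=\sup\{\lambda\in\mathbb{R}_{\geq 0} : (R,I^\lambda)\text{ is }F\text{-pure}\}$ and $\operatorname{fpt}(R)=\operatorname{fpt}(\mathfrak{m}_R)$.
   Formalization: The graph G is additionally assumed connected (with n at least 1): for a closed graph with c connected components the F-pure threshold is 2c, e.g. 4 for the edgeless graph on two vertices, so the claim as stated fails for every disconnected G. *)

(* Defs.v *)
From HB Require Import structures.
From mathcomp Require Import all_boot all_order all_algebra perm.
From mathcomp Require Import boolp classical_sets reals.
From mathcomp Require Import mpoly.

Set Implicit Arguments.
Unset Strict Implicit.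
Unset Printing Implicit Defensive.
Import Order.TTheory GRing.Theory Num.Theory.
Local Open Scope ring_scope.
Local Open Scope classical_set_scope.
Local Open Scope quotient_scope.

Definition ideal_gen (R : comNzRingType) (A : set R) : set R :=
  [set f | exists (m : nat) (c g : 'I_m -> R),
     (forall i, A (g i)) /\ f = \sum_(i < m) c i * g i].

Definition ideal_pow (R : comNzRingType) (I : set R) (k : nat) : set R :=
  ideal_gen [set f | exists g : 'I_k -> R,
     (forall i, I (g i)) /\ f = \prod_(i < k) g i].

(* The Frobenius makes R a finitely generated R-module; for a field K this    *)
(* says [K : K^p] < oo.                                                       *)
Definition F_finite (R : comNzRingType) (p : nat) : Prop :=
  exists (m : nat) (b : 'I_m -> R), forall a : R,
    exists c : 'I_m -> R, a = \sum_(i < m) c i ^+ p * b i.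

(* The R-module R^(1/p^e): the element a stands for a^(1/p^e), so that        *)
(* r a^(1/p^e) = (r^(p^e) a)^(1/p^e).                                         *)
Definition frobenius_root (R : comNzRingType) (p : nat)
  (charRp : p \in [pchar R]) (e : nat) : Type := R.

Section FrobeniusRoots.
Variables (R : comNzRingType) (p : nat) (charRp : p \in [pchar R]) (e : nat).

HB.instance Definition _ := GRing.Zmodule.copy (frobenius_root charRp e) R.

Let fscale (r : R) (a : frobenius_root charRp e) : frobenius_root charRp e :=
  r ^+ (p ^ e)%N * (a : R).

Let fscaleA r s a : fscale r (fscale s a) = fscale (r * s) a.
Proof. by rewrite /fscale mulrA exprMn. Qed.

Let fscale1 : left_id 1 fscale.
Proof. by move=> a; rewrite /fscale expr1n mul1r. Qed.

Let fscaleDr : right_distributive fscale +%R.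
Proof. by move=> r a b; rewrite /fscale mulrDr. Qed.

Let fscaleDl a : {morph fscale^~ a : r s / r + s}.
Proof.
move=> r s; rewrite /fscale exprDn_pchar ?mulrDl //.
by rewrite pnatX pnatE ?charRp // (pcharf_prime charRp).
Qed.

HB.instance Definition _ :=
  GRing.Zmodule_isLmodule.Build R (frobenius_root charRp e)
  fscaleA fscale1 fscaleDr fscaleDl.

(* The inclusion of f^(1/p^e) R into R^(1/p^e) splits. As usual f^(1/p^e) R   *)
(* is meant as the free module on f^(1/p^e): the R-linear map R -> R^(1/p^e)  *)
(* sending 1 to f^(1/p^e) is a split injection. Read as a bare submodule,     *)
(* f = 0 would always qualify and every threshold would be infinite.          *)
Definition root_splits (f : R) : Prop :=
  exists psi : {linear frobenius_root charRp e -> R^o},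
    forall r : R, psi (r *: (f : frobenius_root charRp e)) = r.

End FrobeniusRoots.

Definition F_pure_pair (RR : realType) (R : comNzRingType) (p : nat)
    (charRp : p \in [pchar R]) (I : set R) (lambda : RR) : Prop :=
  exists e0 : nat, forall e : nat, (e0 <= e)%N ->
    exists f : R,
      ideal_pow I (Num.truncn ((p ^ e - 1)%N%:R * lambda)) f /\
      root_splits charRp e f.

Definition fpt (RR : realType) (R : comNzRingType) (p : nat)
    (charRp : p \in [pchar R]) (I : set R) : RR :=
  sup [set lambda : RR | 0 <= lambda /\ F_pure_pair charRp I lambda].

Definition closed_labelling (n : nat) (E : rel 'I_n) : Prop :=
  forall i j k l : 'I_n, (i < j)%N -> (k < l)%N -> E i j -> E k l ->
    (i, j) != (k, l) -> (i = k -> E j l) /\ (j = l -> E i k).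

Definition closed_graph (n : nat) (E : rel 'I_n) : Prop :=
  exists s : {perm 'I_n}, closed_labelling (fun i j => E (s i) (s j)).

(* Connectedness cannot be dropped when the threshold is claimed to be 2: the *)
(* edgeless graph on two vertices is closed, its binomial edge ideal is 0,    *)
(* and a polynomial ring in four variables has F-pure threshold 4.            *)
Definition connected_graph (n : nat) (E : rel 'I_n) : Prop :=
  forall i j : 'I_n, connect E i j.

Section BinomialEdgeIdeal.
Variables (K : fieldType) (n : nat) (E : rel 'I_n).

Notation S := {mpoly K[n + n]}.

Definition xvar (i : 'I_n) : S := 'X_(lshift n i).
Definition yvar (i : 'I_n) : S := 'X_(rshift n i).

Definition edge_binomial (i j : 'I_n) : S :=
  xvar i * yvar j - xvar j * yvar i.

Definition binomial_edge_ideal : {pred S} := fun f =>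
  `[< ideal_gen [set g | exists i j : 'I_n,
        [/\ (i < j)%N, E i j & g = edge_binomial i j]] f >].

Lemma binomial_edge_ideal_closed : idealr_closed binomial_edge_ideal.
Proof.
split.
- apply/asboolP; exists 0%N, (fun=> 0), (fun=> 0).
  by split=> [[]|] //; rewrite big_ord0.
- apply/negP => /asboolP [m [c [g [gE]]]] /(congr1 (meval (fun=> 0))).
  rewrite meval1 raddf_sum big1 => [/eqP|i _]; first by rewrite oner_eq0.
  have [u [v [_ _ ->]]] := gE i.
  by rewrite /= mevalM mevalB !mevalM !mevalXU !mul0r subrr mulr0.
- move=> a u v /asboolP [m1 [c1 [g1 [g1E ->]]]].
  move=> /asboolP [m2 [c2 [g2 [g2E ->]]]].
  apply/asboolP; exists (m1 + m2)%N.
  exists (fun i => match split i with inl j => a * c1 j | inr j => c2 j end).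
  exists (fun i => match split i with inl j => g1 j | inr j => g2 j end).
  split=> [i|]; first by case: (split i).
  rewrite big_split_ord mulr_sumr; congr (_ + _); apply: eq_bigr => i _.
    by rewrite (unsplitK (inl i)) mulrA.
  by rewrite (unsplitK (inr i)).
Qed.

HB.instance Definition _ :=
  isIdealr.Build S binomial_edge_ideal binomial_edge_ideal_closed.

Definition edge_ring : comNzRingType := {ideal_quot binomial_edge_ideal}.

Definition edge_ring_pi : S -> edge_ring :=
  \pi_{ideal_quot binomial_edge_ideal}.

Definition edge_ring_max : set edge_ring :=
  ideal_gen [set a | exists i : 'I_(n + n), a = edge_ring_pi 'X_i].

Lemma pchar_edge_ring (p : nat) : p \in [pchar K] -> p \in [pchar edge_ring].
Proof.
move=> charKp.
have charSp : p \in [pchar S] := rmorph_pchar (@mpolyC (n + n) K) charKp.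
exact: (rmorph_pchar (\pi_{ideal_quot binomial_edge_ideal}) charSp).
Qed.

End BinomialEdgeIdeal.

Arguments edge_ring_max K {n} E.

(* Main.v *)
Require Import Defs.
From HB Require Import structures.
From mathcomp Require Import ssrcomplements mpoly.
From mathcomp Require Import all_boot all_order all_algebra perm.
From mathcomp Require Import boolp classical_sets reals.
From mathcomp Require Import ring lra zify.

(* Write S for the polynomial ring, J for the edge ideal, q = p^e and F_ij    *)
(* for x_i y_j - x_j y_i.                                                     *)
(*                                                                            *)
(* Lower bound. Connectedness and closedness give a labelling in which        *)
(* consecutive vertices are adjacent and every edge ij with i < j spans a     *)
(* clique on [i, j]. Let g be the product of the F_(i,i+1)^(q-1) and Phi a    *)
(* generator of the p^-e-linear maps S -> S. The Pluecker relation            *)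
(* y_(i+1) F_ij = y_i F_(i+1,j) + y_j F_(i,i+1) shows by induction on j - i   *)
(* that Phi (g F_ij S) lies in J, because y_(i+1) is a nonzerodivisor modulo  *)
(* the minors of the clique on [i, j]. So Phi (g _) descends to S / J, and it *)
(* sends (y_1 x_n)^(q-1), of degree 2 (q - 1), to 1. Hence the threshold is   *)
(* attained at 2.                                                             *)
(*                                                                            *)
(* Upper bound. Every p^-e-linear map psi on S / J maps the minimal prime P   *)
(* of all 2-minors to itself. A monomial of degree at least 2 q - 1 has at    *)
(* least q factors x_a or at least q factors y_a; in the first case, modulo   *)
(* P, multiplying m = x_a1 ... x_aq m' by y_k^q amounts to multiplying        *)
(* m'' = y_a1 ... y_aq m' by x_k^q, so that y_k psi(m) = x_k psi(m'') modulo  *)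
(* P. In the domain S / P, contained in a Segre ring, this forces psi(m) to   *)
(* have zero constant term, so no combination of such m is mapped to 1.       *)

Set Implicit Arguments.
Unset Strict Implicit.
Unset Printing Implicit Defensive.
Import Order.TTheory GRing.Theory Num.Theory.
Local Open Scope ring_scope.
Local Open Scope classical_set_scope.
Local Open Scope quotient_scope.

(** * Inverse Frobenius maps on polynomial rings *)

(** A spanning family of minimal size is a basis of K over K^p. Some coordinate of 1 is nonzero;
    taking the p-th root of that coordinate, normalised at 1, gives the retraction. *)
Lemma frobenius_retraction1 (K : fieldType) (p : nat) :
  p \in [pchar K] -> F_finite K p ->
  exists phi : {additive K -> K},
    (forall c d, phi (c ^+ p * d) = c * phi d) /\ phi 1 = 1.
Proof.
move=> charKp hK.
pose spans m := exists b : 'I_m -> K, forall a : K,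
  exists c : 'I_m -> K, a = \sum_(i < m) c i ^+ p * b i.
have : exists m, `[< spans m >] by case: hK => m hm; exists m; apply/asboolP.
case/ex_minnP => m /asboolP [b bspan] m_min.
have FD x y : (x + y) ^+ p = x ^+ p + y ^+ p :> K.
  by rewrite exprDn_pchar // pnatE ?charKp // (pcharf_prime charKp).
have FB x y : (x - y) ^+ p = x ^+ p - y ^+ p :> K.
  by apply/eqP; rewrite eq_sym subr_eq -FD subrK.
have indep (c : 'I_m -> K) : \sum_i c i ^+ p * b i = 0 -> forall i, c i = 0.
  case: m b bspan m_min c => [|m] b bspan m_min c c0 j; first by case: j.
  apply: contrapT => /eqP cj; suff /m_min : `[< spans m >] by rewrite ltnn.
  apply/asboolP.
  exists (fun i => b (lift j i)) => a; have [d ad] := bspan a.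
  (* Subtracting (d_j / c_j)^p times the relation cancels the coefficient of b_j. *)
  exists (fun i => d (lift j i) - d j / c j * c (lift j i)).
  transitivity (\sum_i (d i - d j / c j * c i) ^+ p * b i); last first.
    by rewrite (bigD1_ord j) //= mulfVK // subrr expr0n gtn_eqF
      ?(prime_gt0 (pcharf_prime charKp)) // mul0r add0r.
  rewrite (eq_bigr (fun i =>
    d i ^+ p * b i - (d j / c j) ^+ p * (c i ^+ p * b i))).
    by rewrite sumrB -mulr_sumr c0 mulr0 subr0.
  by move=> i _; rewrite FB exprMn mulrBl mulrA.
have uniq (c d : 'I_m -> K) : \sum_i c i ^+ p * b i = \sum_i d i ^+ p * b i ->
    forall i, c i = d i.
  move=> cd i; apply/eqP; rewrite -subr_eq0; apply/eqP.
  apply: (indep (fun i => c i - d i)).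
  under eq_bigr do rewrite FB mulrBl.
  by rewrite sumrB cd subrr.
have [c cE] := choice bspan.
have [j cj] : exists j, c 1 j != 0.
  apply: contrapT => h; have /eqP := cE 1; rewrite big1 ?oner_eq0 // => i _.
  have -> : c 1 i = 0 by apply: contrapT => /eqP hi; apply: h; exists i.
  by rewrite expr0n gtn_eqF ?mul0r // prime_gt0 // (pcharf_prime charKp).
pose phi a := c a j / c 1 j.
have phiB : {morph phi : x y / x - y}.
  move=> x y; rewrite /phi -mulrBl; congr (_ / _).
  apply: (uniq _ (fun i => c x i - c y i)); rewrite -cE.
  under eq_bigr do rewrite FB mulrBl.
  by rewrite sumrB -!cE.
pose phiA : {additive K -> K} := 
  HB.pack phi (GRing.isZmodMorphism.Build K K phi phiB).
exists phiA; split=> /= [x y|]; last by rewrite /phi divff.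
rewrite /phi mulrA; congr (_ / _).
apply: (uniq _ (fun i => x * c y i)); rewrite -cE.
by under eq_bigr do rewrite exprMn -mulrA; rewrite -mulr_sumr -cE.
Qed.

Lemma frobenius_retraction (K : fieldType) (p e : nat) :
  p \in [pchar K] -> F_finite K p ->
  exists phi : {additive K -> K},
    (forall c d, phi (c ^+ (p ^ e) * d) = c * phi d) /\ phi 1 = 1.
Proof.
move=> charKp /(frobenius_retraction1 charKp) [phi [phiZ phi1]].
elim: e => [|e [psi [psiZ psi1]]].
  by exists idfun; split=> //= c d; rewrite expr1.
exists (psi \o phi); split=> [c d|] /=; last by rewrite phi1.
by rewrite expnSr exprM phiZ psiZ.
Qed.

Section AdditiveExtension.
Variables (N : nat) (R : nzRingType) (V : zmodType).
Variable h : 'X_{1..N} -> {additive R -> V}.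

(** The coefficient maps are only additive because the Cartier map is p^-e-linear, not K-linear. *)
Definition madd (u : {mpoly R[N]}) : V := \sum_(m <- msupp u) h m u@_m.

Lemma maddwE u k : (msize u <= k)%N ->
  madd u = \sum_(m : 'X_{1..N < k}) h m u@_m.
Proof.
pose I := 'X_{1..N < k}.
move=> le_uk; rewrite /madd (big_mksub I) ?msupp_uniq //=; first last.
  by move=> m /msize_mdeg_lt /leq_trans ->.
by rewrite big_rmcond //= => m /memN_msupp_eq0 ->; rewrite raddf0.
Qed.

Fact madd_zmod_morphism : zmod_morphism madd.
Proof.
move=> u v /=; pose k := maxn (msize (u - v)) (maxn (msize u) (msize v)).
rewrite !(maddwE (k := k)) ?leq_max ?leqnn ?orbT // -sumrB.
by apply: eq_bigr => m _; rewrite mcoeffB raddfB.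
Qed.

HB.instance Definition _ :=
  GRing.isZmodMorphism.Build {mpoly R[N]} V madd madd_zmod_morphism.

Lemma maddZX c m : madd (c *: 'X_[m]) = h m c.
Proof.
have [->|c0] := eqVneq c 0; first by rewrite scale0r !raddf0.
by rewrite /madd msuppMCX // big_seq1 mcoeffZ mcoeffX eqxx mulr1.
Qed.

End AdditiveExtension.

Lemma mpoly_add_ind (N : nat) (R : nzRingType) (P : {mpoly R[N]} -> Prop) :
  P 0 -> (forall u v, P u -> P v -> P (u + v)) ->
  (forall c m, P (c *: 'X_[m])) -> forall u, P u.
Proof.
by move=> P0 PD PX u; rewrite [u]mpolyE; apply: big_ind => // m _.
Qed.

Section Cartier.
Variables (K : fieldType) (N q : nat) (phi : {additive K -> K}).

(** The Cartier operator on terms: only q-th powers of monomials times (prod_i X_i)^(q-1) survive.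
    When the test holds, [m i %/ q] is (m_i - (q-1)) / q. *)
Definition cartier_coef (m : 'X_{1..N}) (c : K) : {mpoly K[N]} :=
  if [forall i, m i %% q == q.-1]%N
  then phi c *: 'X_[[multinom m i %/ q | i < N]] else 0.

Fact cartier_coef_zmod_morphism m : zmod_morphism (cartier_coef m).
Proof.
move=> c d; rewrite /cartier_coef; case: ifP => _; last by rewrite subrr.
by rewrite raddfB scalerBl.
Qed.

HB.instance Definition _ m := GRing.isZmodMorphism.Build K {mpoly K[N]}
  (cartier_coef m) (cartier_coef_zmod_morphism m).

Definition cartier : {additive {mpoly K[N]} -> {mpoly K[N]}} :=
  madd cartier_coef.

Lemma cartierZX c m : cartier (c *: 'X_[m]) = cartier_coef m c.
Proof. exact: maddZX. Qed.

Lemma cartierM p e : p \in [pchar K] -> q = (p ^ e)%N ->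
  (forall c d, phi (c ^+ q * d) = c * phi d) ->
  forall u v, cartier (u ^+ q * v) = u * cartier v.
Proof.
move=> charKp qE phiZ u v.
have charSp : p \in [pchar {mpoly K[N]}] := rmorph_pchar (@mpolyC N K) charKp.
have FD (a b : {mpoly K[N]}) : (a + b) ^+ q = a ^+ q + b ^+ q.
  by rewrite exprDn_pchar // qE pnatX pnatE ?charSp // (pcharf_prime charKp).
have q0 : (0 < q)%N by rewrite qE expn_gt0 prime_gt0 // (pcharf_prime charKp).
elim/mpoly_add_ind: u => [|u1 u2 IH1 IH2|c m].
- by rewrite expr0n gtn_eqF // !mul0r raddf0.
- by rewrite FD !mulrDl raddfD /= IH1 IH2.
elim/mpoly_add_ind: v => [|v1 v2 IH1 IH2|d k].
- by rewrite !(mulr0, raddf0).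
- by rewrite !(mulrDr, raddfD) /= IH1 IH2.
rewrite exprZn mpolyXn -scalerAl -scalerAr -mpolyXD scalerA !cartierZX.
rewrite /cartier_coef.
have -> : [forall i, (m *+ q + k)%MM i %% q == q.-1]%N =
          [forall i, k i %% q == q.-1]%N.
  by apply: eq_forallb => i; rewrite mnmDE mulmnE modnMDl.
case: ifP => _; last by rewrite mulr0.
rewrite phiZ -scalerAl -scalerAr scalerA -mpolyXD; congr (_ *: 'X_[_]).
by apply/mnmP => i; rewrite mnmDE !mnmE mulmnE divnMDl.
Qed.

End Cartier.

Arguments cartier_coef {K N} q phi m c.
Arguments cartier {K N} q phi.

(** * Two-minors of a clique *)

Section IdealGen.
Variables (R : comNzRingType) (A : set R).

Lemma ideal_gen_ind (T : R -> Prop) : T 0 ->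
  (forall u v, T u -> T v -> T (u + v)) ->
  (forall c g, A g -> T (c * g)) -> forall u, ideal_gen A u -> T u.
Proof.
by move=> T0 TD TM u [m [c [g [gA ->]]]]; apply: big_ind => // i _; apply: TM.
Qed.

Lemma ideal_gen_mem g : A g -> ideal_gen A g.
Proof.
move=> Ag; exists 1%N, (fun=> 1), (fun=> g); split=> //.
by rewrite big_ord1 mul1r.
Qed.

Lemma ideal_gen0 : ideal_gen A 0.
Proof.
by exists 0%N, (fun=> 0), (fun=> 0); split=> [[]|] //; rewrite big_ord0.
Qed.

Lemma ideal_genM a u : ideal_gen A u -> ideal_gen A (a * u).
Proof.
move=> [m [c [g [gA ->]]]]; exists m, (fun i => a * c i), g; split=> //.
by rewrite mulr_sumr; apply: eq_bigr => i _; rewrite mulrA.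
Qed.

Lemma ideal_genD u v : ideal_gen A u -> ideal_gen A v -> ideal_gen A (u + v).
Proof.
move=> [m1 [c1 [g1 [g1A ->]]]] [m2 [c2 [g2 [g2A ->]]]].
exists (m1 + m2)%N.
exists (fun i => match split i with inl j => c1 j | inr j => c2 j end).
exists (fun i => match split i with inl j => g1 j | inr j => g2 j end).
split=> [i|]; first by case: (split i).
rewrite big_split_ord; congr (_ + _); apply: eq_bigr => i _.
  by rewrite (unsplitK (inl i)).
by rewrite (unsplitK (inr i)).
Qed.

Lemma ideal_genN u : ideal_gen A u -> ideal_gen A (- u).
Proof. by move=> /(ideal_genM (-1)); rewrite mulN1r. Qed.

End IdealGen.

Section Segre.
Variables (K : fieldType) (n : nat).
Notation S := {mpoly K[n + n]}.
Notation x := (@xvar K n).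
Notation y := (@yvar K n).
Notation f := (@edge_binomial K n).

Lemma edge_binomialC i j : f j i = - f i j.
Proof. by rewrite /edge_binomial opprB. Qed.

(** Expansion of the vanishing determinant with rows y, x, y on the columns i, j, k. *)
Lemma edge_binomial_y i j k : y k * f i j = y i * f k j + y j * f i k.
Proof. by rewrite /edge_binomial; ring. Qed.

Definition clique_ideal (A : pred 'I_n) : set S :=
  ideal_gen [set g | exists i j, [/\ A i, A j & g = f i j]].

(** The columns in A become the rank one matrix with columns y_i (c, d), so all minors on A
    vanish. *)
Definition segre_var (A : pred 'I_n) (c d : S) (v : 'I_(n + n)) : S :=
  match split v with
  | inl i => if A i then c * y i else x i
  | inr i => if A i then d * y i else y i
  end.

Definition segre A c d : {rmorphism S -> S} :=
  mmap (@mpolyC (n + n) K) (segre_var A c d).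

Lemma segre_x (A : pred 'I_n) c d i :
  segre A c d (x i) = if A i then c * y i else x i.
Proof. by rewrite /segre /= mmapX mmap1U /segre_var (unsplitK (inl i)). Qed.

Lemma segre_y (A : pred 'I_n) c d i :
  segre A c d (y i) = if A i then d * y i else y i.
Proof. by rewrite /segre /= mmapX mmap1U /segre_var (unsplitK (inr i)). Qed.

Lemma segre_f (A : pred 'I_n) c d i j : A i -> A j -> segre A c d (f i j) = 0.
Proof.
move=> Ai Aj; rewrite /edge_binomial rmorphB !rmorphM !segre_x !segre_y Ai Aj.
by ring.
Qed.

Lemma segre_clique (A : pred 'I_n) c d u :
  clique_ideal A u -> segre A c d u = 0.
Proof.
move: u; apply: ideal_gen_ind => [|u v u0 v0|a _ [i [j [Ai Aj ->]]]].
- by rewrite rmorph0.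
- by rewrite rmorphD u0 v0 addr0.
by rewrite rmorphM segre_f // mulr0.
Qed.

Notation xi i := (lshift n i).
Notation yi i := (rshift n i).

(** On A, this exponent remembers exactly the degree of each column and the total x-degree, the data
    compared in [clique_straighten]. *)
Definition segre_mnm (A : pred 'I_n) (k : 'I_n) (m : 'X_{1..n + n}) :
    'X_{1..n + n} :=
  [multinom match split v with
     | inl i => if A i then (if i == k then \sum_(a | A a) m (xi a) else 0)
                else m (xi i)
     | inr i => if A i then m (xi i) + m (yi i) else m (yi i)
     end%N | v < n + n].

Lemma segre_mnmx (A : pred 'I_n) k m i : segre_mnm A k m (xi i) =
  (if A i then (if i == k then \sum_(a | A a) m (xi a) else 0) else m (xi i))%N.
Proof. by rewrite mnmE (unsplitK (inl i)). Qed.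

Lemma segre_mnmy (A : pred 'I_n) k m i : segre_mnm A k m (yi i) =
  (if A i then m (xi i) + m (yi i) else m (yi i))%N.
Proof. by rewrite mnmE (unsplitK (inr i)). Qed.

Lemma segreX (A : pred 'I_n) k m : A k ->
  segre A (x k) 1 'X_[m] = 'X_[segre_mnm A k m].
Proof.
move=> Ak; rewrite /segre /= mmapX /mmap1 [RHS]mpolyXE_id !big_split_ord /=.
rewrite -[RHS]big_split -[LHS]big_split /=.
rewrite [LHS](bigID A) [RHS](bigID A) /=; congr (_ * _); last first.
  apply: eq_bigr => i /negbTE Ai.
  rewrite /segre_var (unsplitK (inl i)) (unsplitK (inr i)) Ai.
  by rewrite segre_mnmx segre_mnmy Ai.
transitivity (\prod_(i | A i) (x k ^+ m (xi i)) *
              \prod_(i | A i) (y i ^+ (m (xi i) + m (yi i)))).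
  rewrite -big_split; apply: eq_bigr => i Ai.
  rewrite /segre_var (unsplitK (inl i)) (unsplitK (inr i)) Ai mul1r exprMn.
  by rewrite -mulrA -exprD.
rewrite big_split /=; congr (_ * _); last first.
  by apply: eq_bigr => i Ai; rewrite segre_mnmy Ai.
rewrite [RHS](bigD1 k) //= segre_mnmx Ak eqxx [X in _ = _ * X]big1 ?mulr1.
  by rewrite prodrXr.
by move=> i /andP[Ai /negbTE ik]; rewrite segre_mnmx Ai ik expr0.
Qed.

(** A move x_a y_b -> x_b y_a changes a monomial by a multiple of a minor and preserves the
    hypotheses. With a where m has too many x and b where it has too few, it lowers the excess over
    m'. *)
Lemma clique_straighten (A : pred 'I_n) (m m' : 'X_{1..n + n}) :
  (forall a, ~~ A a -> m (xi a) = m' (xi a) /\ m (yi a) = m' (yi a)) ->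
  (forall a, A a -> m (xi a) + m (yi a) = m' (xi a) + m' (yi a))%N ->
  (\sum_(a | A a) m (xi a) = \sum_(a | A a) m' (xi a))%N ->
  clique_ideal A ('X_[m] - 'X_[m']).
Proof.
(* Subtraction is truncated, so only the columns with an excess of x count. *)
move: {2}(\sum_(a | A a) (m (xi a) - m' (xi a)))%N
  (leqnn (\sum_(a | A a) (m (xi a) - m' (xi a)))%N) => d.
elim: d m => [|d IH] m md Am mm ms.
  have le_x a : A a -> (m (xi a) <= m' (xi a))%N.
    by move=> Aa; move: md; rewrite leqn0 sum_nat_eq0 => /forall_inP /(_ a Aa).
  have eq_x a : A a -> m (xi a) = m' (xi a).
    move=> Aa; apply/eqP; rewrite eqn_leq le_x //=.
    move: ms; rewrite (bigD1 a) // [RHS](bigD1 a) //= => ms.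
    rewrite -(leq_add2r (\sum_(i < n | A i && (i != a)) m' (xi i))) -ms.
    by rewrite leq_add2l; apply: leq_sum => i /andP[/le_x].
  have -> : m = m'; last by rewrite subrr; apply: ideal_gen0.
  apply/mnmP => v; rewrite -(splitK v).
  case: (split v) => a /=; case Aa : (A a).
  - exact: eq_x.
  - by case: (Am a); rewrite ?Aa.
  - by have := mm a Aa; rewrite eq_x // => /addnI.
  - by case: (Am a); rewrite ?Aa.
have [/eqP s0|] := eqVneq (\sum_(a | A a) (m (xi a) - m' (xi a)))%N 0%N.
  by apply: IH => //; rewrite (eqP s0).
rewrite sum_nat_eq0 negb_forall_in => s0.
have [a Aa mma] : exists2 a : 'I_n, A a & (m (xi a) - m' (xi a))%N != 0%N.
  by case/exists_inP: s0 => a; exists a.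
have [b Ab mmb] : exists2 b, A b & (m (xi b) < m' (xi b))%N.
  apply: contrapT => h.
  suff : (\sum_(a | A a) m' (xi a) < \sum_(a | A a) m (xi a))%N.
    by rewrite ms ltnn.
  rewrite (bigD1 a) // [X in (_ < X)%N](bigD1 a) //= -addSn leq_add //.
    by lia.
  apply: leq_sum => i /andP[Ai _]; rewrite leqNgt; apply/negP => lt_i.
  by apply: h; exists i.
have ab : a != b by apply: contraTneq mmb => <-; lia.
(* Column b has the same degree in m and m', so lacking x it has a spare y_b: x_a y_b divides m. *)
have mb := mm b Ab; have ma := mm a Aa.
pose m0 := (m - U_(xi a) - U_(yi b))%MM.
have xy i j : xi i != yi j by rewrite eq_lrshift.
have mE : m = (m0 + (U_(xi a) + U_(yi b)))%MM.
  apply/mnmP => v; rewrite !(mnmDE, mnmBE, mnm1E).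
  have [<-|va] := eqVneq (xi a) v.
    by rewrite eq_sym (negbTE (xy _ _)); lia.
  by have [<-|vb] := eqVneq (yi b) v; lia.
pose m2 := (m0 + (U_(xi b) + U_(yi a)))%MM.
have m2x i : m2 (xi i) = (m (xi i) - (a == i) + (b == i))%N.
  rewrite !(mnmDE, mnmBE, mnm1E) !eq_lshift ![yi _ == _]eq_sym.
  rewrite !(negbTE (xy _ _)).
  by lia.
have m2y i : m2 (yi i) = (m (yi i) - (b == i) + (a == i))%N.
  by rewrite !(mnmDE, mnmBE, mnm1E) !eq_rshift !(negbTE (xy _ _)); lia.
rewrite -(subrK 'X_[m2] 'X_[m]) -addrA; apply: ideal_genD.
  rewrite [m in 'X_[m] - _]mE /m2 !mpolyXD -mulrBr; apply: ideal_genM.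
  by apply: ideal_gen_mem; exists a, b.
have nA i j : A i -> ~~ A j -> (i == j) = false.
  by move=> Ai; apply: contraNF => /eqP <-.
have bN a' : (b == a') && (a == a') = false.
  by apply: contraNF ab => /andP[/eqP -> /eqP ->].
apply: IH.
- have: (\sum_(i | A i) (m2 (xi i) - m' (xi i)) <
          \sum_(i | A i) (m (xi i) - m' (xi i)))%N; last by lia.
  rewrite (bigD1 a) // [X in (_ < X)%N](bigD1 a) //= -addSn leq_add //.
    by rewrite m2x eqxx; have := bN a; rewrite eqxx andbT => ->; lia.
  apply: leq_sum => i /andP[Ai _]; rewrite m2x.
  by have [<-|] := eqVneq b i; lia.
- by move=> i Ai; rewrite m2x m2y (nA a) // (nA b) //; case: (Am i Ai); lia.
- move=> i Ai; rewrite m2x m2y; have := mm i Ai; have := bN i.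
  clear m2x m2y mE m2 m0.
  by have [?|_] := eqVneq a i; have [?|_] := eqVneq b i; subst => //=; lia.
rewrite -ms (eq_bigr (fun i => (m (xi i) - (a == i)) + (b == i)))%N //.
have sb : (\sum_(i < n | A i) (b == i) = 1)%N.
  rewrite (bigD1 b) //= eqxx big1 // => i /andP[_ /negbTE ib].
  by rewrite eq_sym ib.
rewrite big_split /= sb (bigD1 a) //= [in RHS](bigD1 a) //= eqxx.
rewrite (eq_bigr (fun i => m (xi i))); last first.
  by move=> i /andP[_ /negbTE ia]; rewrite eq_sym ia subn0.
by move: (bigop _ _ _) => t; lia.
Qed.

(** Choosing one preimage for each monomial in the image gives an additive L such that v - L (segre
    v) lies in the ideal for every v, by straightening on monomials. *)
Lemma segre_eq0_clique (A : pred 'I_n) k u :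
  A k -> segre A (x k) 1 u = 0 -> clique_ideal A u.
Proof.
move=> Ak.
have /choice [rho rhoE] : forall M, exists m,
    (exists m', segre_mnm A k m' = M) -> segre_mnm A k m = M.
  move=> M; have [[m' m'M]|h] := pselect (exists m', segre_mnm A k m' = M).
    by exists m'.
  by exists 0%MM => /h.
have hB M : zmod_morphism (fun c : K => c *: 'X_[rho M] : S).
  by move=> c d; rewrite scalerBl.
pose h M : {additive K -> S} :=
  HB.pack (fun c : K => c *: 'X_[rho M] : S)
          (GRing.isZmodMorphism.Build K S _ (hB M)).
have [L LE] : exists L : {additive S -> S},
    forall M c, L (c *: 'X_[M]) = c *: 'X_[rho M].
  by exists (madd h) => M c; rewrite -[LHS]/(madd h _) maddZX.
suff key v : clique_ideal A (v - L (segre A (x k) 1 v)).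
  by move=> u0; have := key u; rewrite u0 raddf0 subr0.
elim/mpoly_add_ind: v => [|v w vI wI|c m].
- by rewrite rmorph0 [L 0]raddf0 subrr; apply: ideal_gen0.
- rewrite (rmorphD (segre A (x k) 1)) (raddfD L) opprD addrACA.
  exact: ideal_genD.
rewrite -mul_mpolyC rmorphM /= segreX //.
rewrite /segre /= mmapC !mul_mpolyC.
rewrite LE -scalerBr -mul_mpolyC; apply: ideal_genM.
set m' := rho _.
have mm' : segre_mnm A k m' = segre_mnm A k m by apply: rhoE; exists m.
apply: clique_straighten => [a Aa|a Aa|].
- have := congr1 (fun M : 'X_{1..n + n} => (M (xi a), M (yi a))) mm'.
  by rewrite !segre_mnmx !segre_mnmy (negbTE Aa) => -[-> ->].
- have := congr1 (fun M : 'X_{1..n + n} => M (yi a)) mm'.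
  by rewrite !segre_mnmy Aa => ->.
have := congr1 (fun M : 'X_{1..n + n} => M (xi k)) mm'.
by rewrite !segre_mnmx Ak eqxx => ->.
Qed.

(** The ideal is the kernel of a map to a domain that does not kill y_k. *)
Lemma clique_ideal_nzd (A : pred 'I_n) k u :
  A k -> clique_ideal A (y k * u) -> clique_ideal A u.
Proof.
move=> Ak /segre_clique => /(_ (x k) 1) /eqP.
rewrite rmorphM segre_y Ak mul1r mulf_eq0 => /orP[/eqP yk0|/eqP].
  have /eqP := congr1 (mcoeff U_(yi k)) yk0.
  by rewrite mcoeffXU eqxx mcoeff0 oner_eq0.
exact: segre_eq0_clique.
Qed.

End Segre.

(** * Closed labellings *)

Section ClosedLabelling.
Local Open Scope nat_scope.
Variables (n : nat) (E : rel 'I_n).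
Hypotheses (Esym : symmetric E) (Eirr : irreflexive E).
Hypotheses (Econn : connected_graph E) (Eclosed : closed_labelling E).

Let up : rel 'I_n := fun a b => (a < b) && E a b.

Let up_le (a b : 'I_n) : connect up a b -> a <= b.
Proof.
case/connectP => p; elim: p a => [|c p IH] a /=; first by move=> _ ->.
by case/andP=> /andP[ac _] /IH h /h; lia.
Qed.

(** If the path climbs to v and then descends to w, the predecessor of v is w or is adjacent to w by
    closedness at v, so v can be skipped. The bound k drives the induction. *)
Let up_comparable_step_up (u v w : 'I_n) k :
  v <= k -> connect up u v -> E v w ->
  connect up u w || connect up w u.
Proof.
elim: k v => [|k IH] v vk uv Evw; have [vw|wv|/val_inj vw] := ltngtP v w.
- by rewrite (connect_trans uv) // connect1 // /up vw.
- lia.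
- by rewrite vw Eirr in Evw.
- by rewrite (connect_trans uv) // connect1 // /up vw.
- case/connectP: uv => p; case/lastP: p => [_ /= vu|p t].
    by rewrite orbC connect1 // /up -vu wv Esym.
  rewrite rcons_path last_rcons => /andP[up_p /andP[lt_pv Epv]] vt; subst t.
  set t := last u p in lt_pv Epv.
  have ut : connect up u t by apply/connectP; exists p.
  have [<-|tw] := eqVneq t w; first by rewrite ut.
  apply: (IH t) => //; first by lia.
  have Ewv : E w v by rewrite Esym.
  apply: (proj2 (Eclosed lt_pv wv Epv Ewv _)) => //.
  by rewrite xpair_eqE eqxx andbT.
by rewrite vw Eirr in Evw.
Qed.

Let up_comparable_step_down (u v w : 'I_n) k :
  n - v <= k -> connect up v u -> E v w ->
  connect up u w || connect up w u.
Proof.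
elim: k v => [|k IH] v vk vu Evw; first by have := ltn_ord v; lia.
have [vw|wv|/val_inj vw] := ltngtP v w; last by rewrite vw Eirr in Evw.
  case/connectP: vu => -[/= _ ->|t p /= /andP[up_vt tp] ue].
    by rewrite connect1 // /up vw.
  have /andP[vt Evt] := up_vt.
  have tu : connect up t u by apply/connectP; exists p.
  have [<-|tw] := eqVneq t w; first by rewrite tu orbT.
  apply: (IH t) => //; first by have := ltn_ord t; lia.
  apply: (proj1 (Eclosed vt vw Evt Evw _)) => //.
  by rewrite xpair_eqE eqxx.
by rewrite orbC (connect_trans _ vu) // connect1 // /up wv Esym.
Qed.

(* In a closed labelling every two vertices are joined by a monotone path:    *)
(* the neighbours of a local extremum of a path are adjacent or equal, so the *)
(* extremum can be skipped.                                                   *)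
Let up_comparable (u v : 'I_n) : connect up u v || connect up v u.
Proof.
case/connectP: (Econn u v) => p pE ->.
suff key a : path E a p -> connect up u a || connect up a u ->
    connect up u (last a p) || connect up (last a p) u.
  by apply: key => //; rewrite connect0.
elim: p {pE} a => [|c p IH] a //= /andP[Eac pE] h.
apply: IH => //; case/orP: h => h.
  exact: up_comparable_step_up h Eac.
exact: up_comparable_step_down h Eac.
Qed.

(** A monotone path from i to i+1 has no room for another vertex. *)
Lemma closed_labelling_succ (i j : 'I_n) : j = i.+1 :> nat -> E i j.
Proof.
move=> ij; have := up_comparable i j.
have -> : connect up j i = false by apply: contraTF isT => /up_le; lia.
rewrite orbF => /connectP; case=> -[/= _ ji|t p /= /andP[up_it tp] jE].
  by move: ij; rewrite ji; lia.
have /andP[it Eit] := up_it.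
have tj : connect up t j by apply/connectP; exists p.
by rewrite (_ : j = t) //; apply: val_inj => /=; have := up_le tj; lia.
Qed.

(** Move the left end from i up to a, then the right end from j down to b, one unit at a time:
    closedness is applied to the current edge and a consecutive edge. *)
Lemma closed_labelling_clique (i j a b : 'I_n) :
  E i j -> i <= a -> a < b -> b <= j -> E a b.
Proof.
move=> Eij ia ab bj.
have Eaj : E a j.
  have : a < j by lia.
  move: {2}(a - i)%N (leqnn (a - i)) => d.
  elim: d a ia {ab} => [|d IH] a ia ad aj.
    by rewrite (_ : a = i) //; apply: val_inj => /=; lia.
  have [ai|ai] := eqVneq (a : nat) i; first by rewrite (val_inj ai).
  have lt_a : a.-1 < n by have := ltn_ord a; lia.
  pose c := Ordinal lt_a.
  have Ecj : E c j by apply: IH => /=; lia.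
  have Eca : E c a by apply: closed_labelling_succ => /=; lia.
  have lt_ca : c < a by rewrite /=; lia.
  have lt_cj : c < j by rewrite /=; lia.
  apply: (proj1 (Eclosed lt_ca lt_cj Eca Ecj _)) => //.
  by rewrite xpair_eqE eqxx /= -val_eqE /=; lia.
move: {2}(j - b)%N (leqnn (j - b)) => d.
elim: d b ab bj => [|d IH] b ab bj bd.
  by rewrite (_ : b = j) //; apply: val_inj => /=; lia.
have [jb|jb] := eqVneq (b : nat) j; first by rewrite (val_inj jb).
have lt_b : b.+1 < n by have := ltn_ord j; lia.
pose c := Ordinal lt_b.
have Eac : E a c by apply: IH => /=; lia.
have Ebc : E b c by apply: closed_labelling_succ.
have lt_ac : a < c by rewrite /=; lia.
have lt_bc : b < c by rewrite /=; lia.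
apply: (proj2 (Eclosed lt_ac lt_bc Eac Ebc _)) => //.
by rewrite xpair_eqE eqxx andbT -val_eqE /=; lia.
Qed.

End ClosedLabelling.

(** * The product of the binomials along a path *)

Lemma clique_ideal_sub (K : fieldType) n (A B : pred 'I_n) u :
  (forall i, A i -> B i) -> clique_ideal (K := K) A u -> clique_ideal B u.
Proof.
move=> AB; move: u; apply: ideal_gen_ind => [|u v Bu Bv|c _ [i [j [Ai Aj ->]]]].
- exact: ideal_gen0.
- exact: ideal_genD.
by apply: ideal_genM; apply: ideal_gen_mem; exists i, j; rewrite !AB.
Qed.

Section PathProduct.
Variables (K : fieldType) (n q : nat) (v : nat -> 'I_n).
Hypothesis q_gt0 : (0 < q)%N.
Notation S := {mpoly K[n + n]}.
Variable Phi : {additive S -> S}.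
Hypothesis PhiM : forall a b : S, Phi (a ^+ q * b) = a * Phi b.

Let x i := xvar K (v i).
Let y i := yvar K (v i).
Let F i j := edge_binomial K (v i) (v j).

Definition path_prod a b : S := \prod_(a <= k < b) F k k.+1 ^+ q.-1.

Definition segment a b : pred 'I_n :=
  fun w => [exists k : 'I_b.+1, (a <= k)%N && (w == v k)].

Lemma segmentP a b k : (a <= k <= b)%N -> segment a b (v k).
Proof.
move=> /andP[ak kb]; apply/existsP; exists (inord k).
by rewrite inordK ?ltnS // ak eqxx.
Qed.

Lemma segment_sub a b a' b' w :
  (a' <= a)%N -> (b <= b')%N -> segment a b w -> segment a' b' w.
Proof.
move=> a'a bb' /existsP[k /andP[ak /eqP ->]]; apply: segmentP.
by have := ltn_ord k; lia.
Qed.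

(* The Pluecker relation for y_(a+1) splits the path at its second vertex;    *)
(* y_(a+1) may be cancelled at the end because it is a nonzerodivisor modulo  *)
(* the ideal of the clique.                                                   *)
Lemma path_prod_clique a b (c : S) : (a < b)%N ->
  clique_ideal (segment a b) (Phi (c * path_prod a b * F a b)).
Proof.
have exprq (u : S) : u ^+ q = u * u ^+ q.-1 by rewrite -exprS prednK.
move=> ab; have [d bE] : exists d, b = (a + d.+1)%N.
  by exists (b - a).-1; lia.
rewrite {}bE {ab b}; elim: d a c => [|d IH] a c.
  rewrite addn1 /path_prod big_nat1.
  rewrite -mulrA -exprSr prednK // mulrC PhiM mulrC; apply: ideal_genM.
  by apply: ideal_gen_mem; exists (v a), (v a.+1); split=> //; apply: segmentP; lia.
set b := (a + d.+2)%N.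
have bE : b = (a.+1 + d.+1)%N by rewrite /b; lia.
apply: (@clique_ideal_nzd _ _ _ (v a.+1)); first by apply: segmentP; lia.
rewrite -[yvar _ _]/(y a.+1).
have gE : path_prod a b = F a a.+1 ^+ q.-1 * path_prod a.+1 b.
  by rewrite /path_prod big_ltn //; lia.
(* Inside Phi the multiplier is y_(a+1)^q: one factor feeds the Pluecker relation, the others join
   the coefficients. *)
rewrite -PhiM exprq -mulrA mulrCA.
pose c1 := y a.+1 ^+ q.-1 * c * F a a.+1 ^+ q.-1 * y a.
pose c2 := y a.+1 ^+ q.-1 * c * path_prod a.+1 b * y b.
have -> : y a.+1 ^+ q.-1 * (y a.+1 * (c * path_prod a b * F a b)) =
    c1 * path_prod a.+1 b * F a.+1 b + F a a.+1 ^+ q * c2.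
  transitivity (y a.+1 ^+ q.-1 * c * path_prod a b * (y a.+1 * F a b)).
    by ring.
  rewrite [y _ * F _ _]edge_binomial_y gE exprq /c1 /c2.
  rewrite -/(y a) -/(y b) -/(F a.+1 b) -/(F a a.+1); by ring.
rewrite raddfD PhiM; apply: ideal_genD.
  apply: (@clique_ideal_sub _ _ (segment a.+1 b)) => [i|].
    by apply: segment_sub; lia.
  by rewrite bE; apply: IH.
rewrite mulrC; apply: ideal_genM; apply: ideal_gen_mem.
by exists (v a), (v a.+1); split=> //; apply: segmentP; lia.
Qed.

(* Modulo the ideal of all y_k^q, only the terms x_k y_(k+1) of the factors   *)
(* survive.                                                                   *)
Lemma path_prod_mod k (c : S) :
  (Phi (c * (y 0 ^+ q.-1 * path_prod 0 k)))@_0 =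
  (Phi (c * (\prod_(0 <= i < k) (x i * y i) ^+ q.-1 * y k ^+ q.-1)))@_0.
Proof.
elim: k c => [|k IH] c; first by rewrite /path_prod !big_geq // mulr1 mul1r.
rewrite /path_prod !big_nat_recr //= -/(path_prod 0 k).
rewrite (_ : c * _ = c * F k k.+1 ^+ q.-1 * (y 0 ^+ q.-1 * path_prod 0 k));
  last by ring.
rewrite IH.
set P := \prod_(0 <= i < k) _.
(* Modulo y_k only (x_k y_(k+1))^(q-1) remains. Together with y_k^(q-1) the error term contains
   y_k^q, which leaves Phi as y_k and has no constant term. *)
have [r rE] : exists r, F k k.+1 ^+ q.-1 = (x k * y k.+1) ^+ q.-1 + y k * r.
  exists (- x k.+1 * \sum_(i < q.-1) F k k.+1 ^+ (q.-1.-1 - i) * (x k * y k.+1) ^+ i).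
  apply/eqP; rewrite addrC -subr_eq subrXX mulrA; apply/eqP; congr (_ * _).
  by rewrite /F /edge_binomial -/(x k) -/(x k.+1) -/(y k) -/(y k.+1); ring.
rewrite rE.
have -> : c * ((x k * y k.+1) ^+ q.-1 + y k * r) * (P * y k ^+ q.-1) =
  c * (P * (x k * y k) ^+ q.-1 * y k.+1 ^+ q.-1) + y k ^+ q * (c * r * P).
  have -> : y k ^+ q = y k * y k ^+ q.-1 by rewrite -exprS prednK.
  by rewrite !exprMn; ring.
rewrite raddfD PhiM mcoeffD rmorphM /=.
rewrite [X in _ + X * _](_ : _ = 0) ?mul0r ?addr0 //.
by rewrite mcoeffX mnm1_eq0.
Qed.

End PathProduct.

(** N (q-1) is the least degree of a monomial whose exponents are all q-1 modulo q. *)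
Lemma cartier_const (K : fieldType) N q (phi : {additive K -> K})
    (u : {mpoly K[N]}) :
  (0 < q)%N -> u \is (N * q.-1).-homog ->
  cartier q phi u = ((cartier q phi u)@_0)%:MP.
Proof.
move=> q0 /dhomogP uh.
have key m : m \in msupp u ->
    exists c, cartier_coef q phi m u@_m = c%:MP.
  move=> mu; rewrite /cartier_coef; case: ifP => [/forallP mq|_]; last first.
    by exists 0; rewrite mpolyC0.
  exists (phi u@_m); rewrite -[RHS]mulr1 mul_mpolyC; congr (_ *: _).
  rewrite -mpolyX0; congr 'X_[_]; apply/mnmP => i; rewrite mnmE mnm0E.
  have le_m j : (q.-1 <= m j)%N by rewrite -(eqP (mq j)) leq_mod.
  have := uh m mu; rewrite /= mdegE (bigD1 i) //= => m_deg.
  have : (\sum_(j < N | j != i) q.-1 <= \sum_(j < N | j != i) m j)%N.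
    by apply: leq_sum => j _; apply: le_m.
  have : (\sum_(j < N) q.-1 = N * q.-1)%N by rewrite sum_nat_const card_ord.
  rewrite (bigD1 i) //=; move: m_deg.
  move: (\sum_(_ < _ | _) m _)%N (\sum_(_ < _ | _) q.-1)%N => s1 s2 h1 h2 h3.
  by rewrite divn_small //; have := le_m i; lia.
rewrite [cartier q phi u]/(madd _ _) /madd.
have : {subset msupp u <= msupp u} by [].
elim: {1 3 4}(msupp u) => [|m r IH] ru; first by rewrite !big_nil mcoeff0 mpolyC0.
rewrite !big_cons mcoeffD mpolyCD -IH => [|k kr]; last first.
  by apply: ru; rewrite inE kr orbT.
have [c cE] := key m (ru m (mem_head _ _)).
by rewrite /= cE mcoeffC eqxx mulr1.
Qed.

Lemma cartier_boxX (K : fieldType) N q (phi : {additive K -> K}) :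
  (0 < q)%N -> phi 1 = 1 ->
  cartier q phi ('X_[[multinom q.-1 | i < N]] : {mpoly K[N]}) = 1.
Proof.
move=> q0 phi1; rewrite -['X_[_]]scale1r cartierZX /cartier_coef.
rewrite ifT; last by apply/forallP => i; rewrite mnmE modn_small ?prednK.
rewrite phi1 scale1r -mpolyX0; congr 'X_[_]; apply/mnmP => i.
by rewrite !mnmE divn_small // prednK.
Qed.

Section PathWitness.
Variables (K : fieldType) (n q : nat) (s : {perm 'I_n.+1}).
Hypothesis q_gt0 : (0 < q)%N.
Notation S := {mpoly K[n.+1 + n.+1]}.
Variable phi : {additive K -> K}.
Hypothesis phi1 : phi 1 = 1.
Hypothesis PhiM : forall a b : S,
  cartier q phi (a ^+ q * b) = a * cartier q phi b.

Let v (i : nat) : 'I_n.+1 := s (inord i).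

(** The argument has degree 2n (q-1) + 2 (q-1), so its image is constant; by [path_prod_mod] that
    constant comes from the product of all variables to the power q-1. *)
Lemma path_prod_witness :
  cartier q phi (path_prod K q v 0 n *
    (yvar K (v 0) * xvar K (v n)) ^+ q.-1) = 1.
Proof.
have homX i : ('X_i : S) \is 1.-homog by rewrite dhomogX /= mdeg1.
have homxy (i j : 'I_n.+1) : xvar K i * yvar K j \is 2.-homog.
  exact: (dhomogM (homX _) (homX _)).
have homyx (i j : 'I_n.+1) : yvar K i * xvar K j \is 2.-homog.
  exact: (dhomogM (homX _) (homX _)).
have homF (i j : 'I_n.+1) : edge_binomial K i j \is 2.-homog.
  by apply: rpredB; apply: homxy.
have homP k : path_prod K q v 0 k \is (k * (2 * q.-1)).-homog.
  elim: k => [|k IH]; first by rewrite /path_prod big_geq // dhomog1.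
  rewrite /path_prod big_nat_recr //= mulSn addnC.
  by apply: dhomogM => //; apply: dhomogMn.
rewrite cartier_const //; last first.
  have -> : ((n.+1 + n.+1) * q.-1 = n * (2 * q.-1) + (1 + 1) * q.-1)%N by lia.
  by apply: dhomogM => //; apply: dhomogMn.
rewrite exprMn mulrA mulrC [X in _ * X]mulrC.
rewrite (path_prod_mod v q_gt0 PhiM).
set m := _ * _; suff -> : m = 'X_[[multinom q.-1 | i < n.+1 + n.+1]].
  by rewrite cartier_boxX // mcoeff1 eqxx mpolyC1.
rewrite /m mulrCA -exprMn.
rewrite -(big_nat_recr n 0 (fun i => (xvar K (v i) * yvar K (v i)) ^+ q.-1)) //=.
rewrite big_mkord mpolyXE_id big_split_ord /= -big_split /=.
rewrite [RHS](reindex_inj (@perm_inj _ s)); apply: eq_bigr => i _.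
by rewrite !mnmE exprMn /v inord_val.
Qed.

End PathWitness.

(** * Edge rings and the lower bound *)

Section EdgeRing.
Variables (K : fieldType) (n : nat) (E : rel 'I_n).
Notation S := {mpoly K[n + n]}.
Notation R := (edge_ring K E).
Notation pi := (@edge_ring_pi K n E).

HB.instance Definition _ := GRing.RMorphism.copy (pi : S -> R)
  (\pi_{ideal_quot (@binomial_edge_ideal K n E)} : S -> R).

Definition edge_ideal : set S :=
  ideal_gen [set g | exists i j : 'I_n,
    [/\ (i < j)%N, E i j & g = edge_binomial K i j]].

Lemma edge_ring_pi_eq u v : pi u = pi v <-> edge_ideal (u - v).
Proof.
split=> [uv|uv].
  have : (u - v) \in @binomial_edge_ideal K n E.
    by rewrite Quotient.idealrBE; apply/eqP.
  by move/asboolP.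
by apply/eqP; rewrite -Quotient.idealrBE; apply/asboolP.
Qed.

Lemma edge_ring_pi_eq0 u : pi u = 0 <-> edge_ideal u.
Proof. by rewrite -(rmorph0 pi) edge_ring_pi_eq subr0. Qed.

Lemma edge_ring_reprK (r : R) : pi (repr r) = r.
Proof. exact: reprK. Qed.

Hypotheses (Esym : symmetric E) (Eirr : irreflexive E).

Lemma edge_ideal_edge i j : E i j -> edge_ideal (edge_binomial K i j).
Proof.
move=> Eij; have [ij|ji|/val_inj ij] := ltngtP i j.
- by apply: ideal_gen_mem; exists i, j.
- rewrite edge_binomialC; apply: ideal_genN.
  by apply: ideal_gen_mem; exists j, i; rewrite Esym.
by rewrite ij Eirr in Eij.
Qed.

Lemma clique_edge_ideal (A : pred 'I_n) u :
  (forall i j, A i -> A j -> i != j -> E i j) ->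
  clique_ideal A u -> edge_ideal u.
Proof.
move=> AE; move: u; apply: ideal_gen_ind => [|u v|c _ [i [j [Ai Aj ->]]]].
- exact: ideal_gen0.
- exact: ideal_genD.
apply: ideal_genM; have [->|ij] := eqVneq i j; last exact/edge_ideal_edge/AE.
by rewrite /edge_binomial subrr; apply: ideal_gen0.
Qed.

End EdgeRing.

Section LowerBound.
Variables (K : fieldType) (p : nat) (charKp : p \in [pchar K]).
Hypothesis hK : F_finite K p.
Variables (n : nat) (E : rel 'I_n.+1).
Hypotheses (Esym : symmetric E) (Eirr : irreflexive E).
Hypotheses (Econn : connected_graph E) (Eclosed : closed_graph E).
Notation S := {mpoly K[n.+1 + n.+1]}.
Notation R := (edge_ring K E).
Notation pi := (@edge_ring_pi K n.+1 E).

Lemma relabel_connected (s : {perm 'I_n.+1}) :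
  connected_graph (fun i j => E (s i) (s j)).
Proof.
move=> i j; have /connectP [c cE jE] := Econn (s i) (s j).
elim: c i cE jE => [|k c IH] i /=; first by move=> _ /perm_inj ->.
move=> /andP[Eik cE] jE.
apply: (@connect_trans _ _ ((s^-1)%g k)); last by apply: IH; rewrite permKV.
by apply: connect1; rewrite permKV.
Qed.

Lemma root_splits_witness e : exists f : R,
  ideal_pow (edge_ring_max K E) ((p ^ e - 1) * 2)%N f /\
  root_splits (pchar_edge_ring E charKp) e f.
Proof.
set q := (p ^ e)%N.
have p_prime := pcharf_prime charKp.
have q0 : (0 < q)%N by rewrite expn_gt0 prime_gt0.
have [phi [phiZ phi1]] := frobenius_retraction e charKp hK.
have PhiM := @cartierM K (n.+1 + n.+1) q phi p e charKp erefl phiZ.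
have [s Es] := Eclosed.
pose v i := s (inord i).
pose g : S := path_prod K q v 0 n.
have gJ u : edge_ideal E u -> edge_ideal E (cartier q phi (g * u)).
  have Esym' : symmetric (fun i j => E (s i) (s j)) by move=> i j; apply: Esym.
  have Eirr' : irreflexive (fun i j => E (s i) (s j)) by move=> i; apply: Eirr.
  have cliq := closed_labelling_clique Esym' Eirr' (relabel_connected s) Es.
  have key c (i j : 'I_n.+1) : (i < j)%N -> E (s i) (s j) ->
      edge_ideal E (cartier q phi (g * (c * edge_binomial K (s i) (s j)))).
    move=> ij Eij; have ltj := ltn_ord j.
    (* The factors outside [i, j] are absorbed into the arbitrary coefficient. *)
    have -> : g = path_prod K q v 0 i * path_prod K q v j n * path_prod K q v i j.
      rewrite /g /path_prod (@big_cat_nat _ _ _ i) //=; last by lia.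
      by rewrite [X in _ * X](@big_cat_nat _ _ _ j) //=; [ring|lia].
    rewrite mulrA [_ * c]mulrC mulrA.
    have -> : s i = v i by rewrite /v inord_val.
    have -> : s j = v j by rewrite /v inord_val.
    apply: (clique_edge_ideal Esym Eirr _ (path_prod_clique v q0 PhiM _ ij)).
    move=> a b /existsP[a' /andP[ia /eqP ->]] /existsP[b' /andP[ib /eqP ->]] ab.
    have lta := ltn_ord a'; have ltb := ltn_ord b'.
    have [lt|lt|eq] := ltngtP a' b'; last by rewrite eq eqxx in ab.
      by apply: (cliq i j) => //; rewrite !inordK //; lia.
    by rewrite Esym; apply: (cliq i j) => //; rewrite !inordK //; lia.
  move: u; apply: ideal_gen_ind => [|a b|c _ [i [j [_ Eij ->]]]].
  - by rewrite mulr0 raddf0; apply: ideal_gen0.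
  - by rewrite mulrDr raddfD; apply: ideal_genD.
  rewrite -[i](permKV s) -[j](permKV s).
  set i' := (s^-1)%g i; set j' := (s^-1)%g j.
  have Eij' : E (s i') (s j') by rewrite !permKV.
  have [ij|ji|/val_inj ij] := ltngtP i' j'; first exact: key.
    rewrite edge_binomialC !mulrN raddfN; apply: ideal_genN; apply: key => //.
    by rewrite Esym.
  by rewrite ij Eirr in Eij'.
pose psi (r : frobenius_root (pchar_edge_ring E charKp) e) : R^o :=
  pi (cartier q phi (g * repr (r : R))).
have psiE u : psi (pi u) = pi (cartier q phi (g * u)).
  apply/edge_ring_pi_eq; rewrite -raddfB -mulrBr; apply: gJ.
  by apply/edge_ring_pi_eq; rewrite edge_ring_reprK.
have psi_lin : linear psi.
  move=> a r t.
  rewrite -[r](edge_ring_reprK (r : R)) -[t](edge_ring_reprK (t : R)).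
  rewrite -[a](edge_ring_reprK (a : R)).
  set a' := repr a; set r' := repr _; set t' := repr _.
  have -> : pi a' *: (pi r' : frobenius_root (pchar_edge_ring E charKp) e)
     + pi t' = pi (a' ^+ q * r' + t') by rewrite rmorphD rmorphM rmorphXn.
  rewrite !psiE mulrDr raddfD mulrCA /= PhiM rmorphD rmorphM //.
pose psiL : {linear frobenius_root (pchar_edge_ring E charKp) e -> R^o} :=
  HB.pack psi (GRing.isLinear.Build _ _ _ _ psi psi_lin).
exists (pi ((yvar K (v 0) * xvar K (v n)) ^+ q.-1)); split.
  apply: ideal_gen_mem.
  (* The 2 (q-1) linear factors alternate between the two variables of the witness. *)
  exists (fun k => if odd k then pi (yvar K (v 0)) else pi (xvar K (v n))).
  split=> [k|].
    by case: odd; apply: ideal_gen_mem; eexists.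
  rewrite rmorphXn rmorphM /= -subn1.
  elim: (q - 1)%N => [|k IH]; first by rewrite big_ord0.
  by rewrite mulSn addnC addn2 !big_ord_recr /= -IH oddM andbF /= exprSr; ring.
exists psiL => r; rewrite linearZ /=.
rewrite psiE /g path_prod_witness // rmorph1; exact: mulr1.
Qed.

End LowerBound.

(** * The upper bound *)

(** Compare the coefficients of the monomial X_i: it is the constant term of a on the left and 0 on
    the right. *)
Lemma mcoeff0_crossing (K : fieldType) N (i j : 'I_N) (a b : {mpoly K[N]}) :
  i != j -> 'X_i * a = 'X_j * b -> a@_0 = 0.
Proof.
move=> ij /(congr1 (fun u => (mderiv i u)@_0)).
have X0 k : ('X_k : {mpoly K[N]})@_0 = 0 by rewrite mcoeffX mnm1_eq0.
rewrite !mderivM !mcoeffD !rmorphM /= !X0 !mul0r !addr0 !mderivX !mnm1E.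
rewrite eqxx eq_sym (negbTE ij) scale0r mcoeff0 mul0r.
rewrite scale1r (_ : (U_(i) - U_(i))%MM = 0%MM) ?mcoeffX ?eqxx ?mul1r //.
by apply/mnmP => l; rewrite mnmBE subnn mnm0E.
Qed.

Lemma prod_var_split (K : fieldType) n (w : seq 'I_(n + n)) :
  exists xs ys : seq 'I_n, (size xs + size ys = size w)%N /\
    \prod_(v <- w) 'X_v = (\prod_(a <- xs) xvar K a) * \prod_(a <- ys) yvar K a.
Proof.
elim: w => [|v w [xs [ys [sE wE]]]].
  by exists [::], [::]; rewrite !big_nil mulr1.
rewrite -(splitK v) /=; case: (split v) => i.
  exists (i :: xs), ys; rewrite /= addSn sE; split=> //.
  by rewrite !big_cons wE mulrA.
exists xs, (i :: ys); rewrite /= addnS sE; split=> //.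
by rewrite !big_cons wE mulrCA.
Qed.

Section UpperBound.
Variables (K : fieldType) (p : nat) (charKp : p \in [pchar K]).
Variables (n : nat) (E : rel 'I_n) (k : 'I_n).
Hypotheses (Esym : symmetric E) (Eirr : irreflexive E).
Hypotheses (Econn : connected_graph E).
Notation S := {mpoly K[n + n]}.
Notation R := (edge_ring K E).
Notation pi := (@edge_ring_pi K n E).
Notation x := (@xvar K n).
Notation y := (@yvar K n).
Notation f := (@edge_binomial K n).

(** With (c, d) = (x_k, y_k), x_k and y_k keep their ratio, which makes both sides of [psi_cross]
    fit [mcoeff0_crossing]. *)
Let theta : {rmorphism S -> S} := segre xpredT (x k) (y k).
Let thetaR (r : R) : S := theta (repr r).

Let theta_f i j : theta (f i j) = 0. Proof. exact: segre_f. Qed.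

Let theta_ideal u : edge_ideal E u -> theta u = 0.
Proof.
move: u; apply: ideal_gen_ind => [|u v u0 v0|a _ [i [j [_ _ ->]]]].
- by rewrite rmorph0.
- by rewrite rmorphD u0 v0 addr0.
by rewrite rmorphM theta_f mulr0.
Qed.

Let thetaR_pi u : thetaR (pi u) = theta u.
Proof.
apply/eqP; rewrite -subr_eq0 -rmorphB; apply/eqP/theta_ideal.
by apply/edge_ring_pi_eq; rewrite edge_ring_reprK.
Qed.

Let thetaRD r t : thetaR (r + t) = thetaR r + thetaR t.
Proof.
rewrite -[r](edge_ring_reprK r) -[t](edge_ring_reprK t) -rmorphD !thetaR_pi.
by rewrite rmorphD.
Qed.

Let thetaRM r t : thetaR (r * t) = thetaR r * thetaR t.
Proof.
rewrite -[r](edge_ring_reprK r) -[t](edge_ring_reprK t) -rmorphM !thetaR_pi.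
by rewrite rmorphM.
Qed.

Let X_neq0 i : ('X_i : S) != 0.
Proof.
apply/eqP => /(congr1 (mcoeff U_(i))) /eqP.
by rewrite mcoeffXU eqxx mcoeff0 oner_eq0.
Qed.

(* The kernel of the localization of S / J_G at the minimal prime generated   *)
(* by all the 2-minors, pulled back to S.                                     *)
Let torsion u := exists z, theta z != 0 /\ edge_ideal E (z * u).

Let torsionD u v : torsion u -> torsion v -> torsion (u + v).
Proof.
move=> [a [a0 au]] [b [b0 bv]]; exists (a * b); split.
  by rewrite (rmorphM theta) mulf_neq0.
rewrite (_ : _ * _ = b * (a * u) + a * (b * v)); last by ring.
by apply: ideal_genD; apply: ideal_genM.
Qed.

Let torsionM a u : torsion u -> torsion (a * u).
Proof.
move=> [z [z0 zu]]; exists z; split=> //.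
by rewrite mulrCA; apply: ideal_genM.
Qed.

Let torsion_cancel z u : theta z != 0 -> torsion (z * u) -> torsion u.
Proof.
move=> z0 [a [a0 au]]; exists (a * z); split; last by rewrite -[a * z * u]mulrA.
by rewrite (rmorphM theta) mulf_neq0.
Qed.

Let torsion_ideal u : edge_ideal E u -> torsion u.
Proof. by exists 1; rewrite rmorph1 oner_eq0 mul1r. Qed.

(** Induction along a path from i to j: the Pluecker relation for y at the last but one vertex
    reduces to an edge and a shorter path. *)
Let torsion_f i j : torsion (f i j).
Proof.
have /connectP [c cE ->] := Econn i j.
elim/last_ind: c cE => [|c a IH] /=.
  by rewrite /edge_binomial subrr => _; apply/torsion_ideal/ideal_gen0.
rewrite rcons_path last_rcons => /andP[/IH ci Ea].
apply: (@torsion_cancel (y (last i c))).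
  by rewrite /theta segre_y mulf_neq0 // X_neq0.
rewrite edge_binomial_y; apply: torsionD; apply: torsionM => //.
exact/torsion_ideal/edge_ideal_edge.
Qed.

(** Each x_a is traded for y_a through y_k x_a - x_k y_a = F_ak. *)
Let torsion_prod (l : seq 'I_n) c :
  torsion (y k ^+ size l * (c * \prod_(a <- l) x a) -
           x k ^+ size l * (c * \prod_(a <- l) y a)).
Proof.
elim: l c => [|a l IH] c.
  by rewrite /= !big_nil subrr; apply/torsion_ideal/ideal_gen0.
rewrite /= !big_cons !exprS.
set P := \prod_(_ <- _) _; set P' := \prod_(_ <- _) _.
rewrite (_ : _ - _ = (y k ^+ size l * (y k * x a * c * P) -
    x k ^+ size l * (y k * x a * c * P')) + x k ^+ size l * c * P' * f a k).
  by apply: torsionD; [apply: IH|apply: torsionM].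
by rewrite /edge_binomial; ring.
Qed.

Section Splitting.
Variables (e : nat).
Notation charRp := (pchar_edge_ring E charKp).
Variable psi : {linear frobenius_root charRp e -> R^o}.
Notation q := (p ^ e)%N.

Let psiR (r : R) : R := psi (r : frobenius_root charRp e).

Let psiRD r t : psiR (r + t) = psiR r + psiR t.
Proof. exact: (raddfD psi). Qed.

Let psiRM a r : psiR (a ^+ q * r) = a * psiR r.
Proof.
rewrite /psiR; set t : frobenius_root charRp e := r.
by rewrite -[_ * _ : R]/(a *: t : frobenius_root charRp e) linearZ.
Qed.

(** If z u is in J, so is z^q u, hence z psi(u) = psi(z^q u) = 0, and theta z can be cancelled in
    the domain S. *)
Let psi_torsion u : torsion u -> thetaR (psiR (pi u)) = 0.
Proof.
move=> [z [z0 zu]]; have zu0 : pi z ^+ q * pi u = 0.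
  rewrite -rmorphXn -rmorphM; apply/edge_ring_pi_eq0.
  have q0 : (0 < q)%N by rewrite expn_gt0 prime_gt0 // (pcharf_prime charKp).
  by rewrite -(prednK q0) exprSr -mulrA; apply: ideal_genM.
apply: (mulfI z0); rewrite mulr0 -thetaR_pi -thetaRM -psiRM zu0.
have -> : psiR 0 = 0 by exact: (raddf0 psi).
by rewrite -(rmorph0 pi) thetaR_pi rmorph0.
Qed.

Let psi_congr u v : torsion (u - v) -> thetaR (psiR (pi u)) = thetaR (psiR (pi v)).
Proof.
move=> /psi_torsion uv.
by rewrite -[u](subrK v) rmorphD psiRD thetaRD uv add0r.
Qed.

Let psi_cross (l : seq 'I_n) c : size l = q ->
  y k * thetaR (psiR (pi (c * \prod_(a <- l) x a))) =
  x k * thetaR (psiR (pi (c * \prod_(a <- l) y a))).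
Proof.
move=> lq; have /psi_congr := torsion_prod l c.
rewrite lq !rmorphM !rmorphXn !psiRM !thetaRM !thetaR_pi /theta segre_x segre_y.
rewrite -!rmorphM => h; apply: (mulfI (X_neq0 (rshift n k))).
by rewrite mulrA h mulrA; congr (_ * _); rewrite mulrC.
Qed.

(** Pigeonhole: among 2q-1 variables, q are of type x or q are of type y. *)
Let psi_var (w : seq 'I_(n + n)) c : (q.*2 <= (size w).+1)%N ->
  (thetaR (psiR (pi (c * \prod_(v <- w) 'X_v))))@_0 = 0.
Proof.
have [xs [ys [sE ->]]] := prod_var_split K w; rewrite -{}sE => hq.
have xy : rshift n k != lshift n k by rewrite eq_rlshift.
have [qx|qx] := leqP q (size xs).
  rewrite -(cat_take_drop q xs) big_cat /=.
  set P := \prod_(_ <- take _ _) _; set P1 := \prod_(_ <- _) _.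
  set P2 := \prod_(_ <- _) _.
  rewrite (_ : c * _ = c * P1 * P2 * P); last by ring.
  exact: mcoeff0_crossing xy (psi_cross _ (size_takel qx)).
have qy : (q <= size ys)%N by lia.
rewrite -(cat_take_drop q ys) big_cat /=.
set P := \prod_(_ <- _) _; set P1 := \prod_(_ <- take _ _) _.
set P2 := \prod_(_ <- _) _.
rewrite (_ : c * _ = c * P * P2 * P1); last by ring.
rewrite eq_sym in xy.
exact: mcoeff0_crossing xy (esym (psi_cross _ (size_takel qy))).
Qed.

Lemma not_root_splits N (r : R) : (q.*2 <= N.+1)%N ->
  ideal_pow (edge_ring_max K E) N r -> psiR r <> 1.
Proof.
move=> hN rN r1.
(* Quantifying over a makes T an ideal. *)
pose T (t : R) := forall a, (thetaR (psiR (a * t)))@_0 = 0.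
have T0 : T 0.
  move=> a; rewrite mulr0 (raddf0 psi : psiR 0 = 0) -(rmorph0 pi) thetaR_pi.
  by rewrite rmorph0 mcoeff0.
have TD t t' : T t -> T t' -> T (t + t').
  by move=> h h' a; rewrite mulrDr psiRD thetaRD mcoeffD h h' addr0.
have TM c t : T t -> T (c * t) by move=> h a; rewrite mulrA.
(* The factors in [gs] are expanded one by one into variables, collected in [w]. *)
have words (gs : seq R) (w : seq 'I_(n + n)) :
    (forall g, g \in gs -> edge_ring_max K E g) ->
    (q.*2 <= (size gs + size w).+1)%N ->
    T ((\prod_(g <- gs) g) * \prod_(v <- w) pi 'X_v).
  elim: gs w => [|g gs IH] w gM gsz.
    move=> a; rewrite big_nil mul1r -rmorph_prod -(edge_ring_reprK a) -rmorphM.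
    exact: psi_var.
  rewrite big_cons -mulrA mulrC.
  have : edge_ring_max K E g by apply: gM; rewrite mem_head.
  have {}IH v : T (\prod_(h <- gs) h * \prod_(u <- v :: w) pi 'X_u).
    apply: IH => [h hgs|]; last by rewrite /= addnS -addSn.
    by apply: gM; rewrite inE hgs orbT.
  move: g {gM gsz}; apply: ideal_gen_ind => [|g h Tg Th|b _ [v ->]].
  - by rewrite mulr0.
  - by rewrite mulrDr; apply: TD.
  by rewrite mulrCA; apply: TM; have := IH v; rewrite big_cons mulrCA mulrC.
suff /(_ 1) : T r.
  rewrite mul1r r1 -(rmorph1 pi) thetaR_pi rmorph1 mcoeff1 eqxx => /eqP.
  by rewrite oner_eq0.
move: r rN {r1}; apply: ideal_gen_ind => // c _ [g [gM ->]].
apply: TM; have := words (map g (enum 'I_N)) [::].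
rewrite big_nil mulr1 big_map big_enum; apply.
  by move=> _ /mapP[i _ ->].
by rewrite size_map size_enum_ord addn0.
Qed.

End Splitting.
End UpperBound.

(** * The value of the threshold *)

Theorem corollary3p3 (RR : realType) (K : fieldType) (p : nat)
    (charKp : p \in [pchar K]) (hK : F_finite K p)
    (n : nat) (hn : (0 < n)%N) (E : rel 'I_n)
    (Esym : symmetric E) (Eirr : irreflexive E)
    (Econn : connected_graph E) (Eclosed : closed_graph E) :
  fpt RR (pchar_edge_ring E charKp) (edge_ring_max K E) = 2.
Proof.
have p_gt1 := prime_gt1 (pcharf_prime charKp).
case: n hn E Esym Eirr Econn Eclosed => // n _ E Esym Eirr Econn Eclosed.
set A := [set lambda : RR | 0 <= lambda /\
  F_pure_pair (pchar_edge_ring E charKp) (edge_ring_max K E) lambda].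
have A2 : A 2.
  split=> //; exists 0%N => e _.
  have [f [fm fs]] := root_splits_witness charKp hK Esym Eirr Econn Eclosed e.
  by exists f; split=> //; rewrite -natrM natrK.
have ubA : ubound A 2.
  move=> lambda [lambda_ge0 [e0 pure]]; rewrite leNgt; apply/negP => lambda_gt2.
  (* This e gives (p^e - 1) (lambda - 2) >= 1, so the exponent of the power of the maximal ideal is
     at least 2 p^e - 1. *)
  pose e := maxn e0 (Num.truncn (lambda - 2)^-1).+1.
  have [f [fm [psi psif]]] := pure e (leq_maxl _ _).
  apply: (not_root_splits (psi := psi) ord0 Esym Eirr Econn _ fm); last first.
    by have := psif 1; rewrite scale1r.
  have lt_e := ltn_expl e p_gt1.
  set d := (p ^ e - 1)%N; have -> : (p ^ e = d.+1)%N by rewrite /d; lia.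
  suff : (d.*2.+1 <= Num.truncn (d%:R * lambda))%N by rewrite doubleS.
  rewrite truncn_ge_nat ?mulr_ge0 //.
  have d_ge : (lambda - 2)^-1 <= d%:R :> RR.
    apply: (@le_trans _ _ (Num.truncn (lambda - 2)^-1).+1%:R).
      exact/ltW/truncnS_gt.
    have := leq_maxr e0 (Num.truncn (lambda - 2)^-1).+1.
    by rewrite ler_nat -/e /d; lia.
  have : 1 <= d%:R * (lambda - 2) :> RR.
    by rewrite -ler_pdivrMr ?subr_gt0 // div1r.
  have -> : d.*2.+1%:R = d%:R * 2 + 1 :> RR by rewrite -(natr1 d.*2) -muln2 natrM.
  by rewrite mulrBr; lra.
apply/eqP; rewrite eq_le; apply/andP; split.
  by apply: ge_sup => //; exists 2.
by apply: ub_le_sup => //; exists 2.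
Qed.
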